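(* Let $u\in L^0(\mathcal{F})$ be such that $E^{\mathcal{A}}M_u$ is bounded on $L^2(\mathcal{F})$, and let $A\in\mathcal{F}$. Then the closed subspace $L^2(A)=\{f\in L^2(\mathcal{F}): f=0 \text{ a.e. on } X\setminus A\}$ reduces $E^{\mathcal{A}}M_u$ if and only if $E^{\mathcal{A}}(\chi_A)=\chi_A$ a.e. on $S(E^{\mathcal{A}}(|u|^2))$.
   Context: $(X,\mathcal{F},\mu)$ is a complete $\sigma$-finite measure space and $\mathcal{A}\subseteq\mathcal{F}$ is a $\sigma$-subalgebra such that $(X,\mathcal{A},\mu|_{\mathcal{A}})$ is $\sigma$-finite. $E^{\mathcal{A}}$ is the conditional expectation with respect to $\mathcal{A}$: for $f\ge 0$ measurable or $f\in L^2(\mathcal{F})$, $E^{\mathcal{A}}f$ is the unique $\mathcal{A}$-measurable function with $\int_B f\,d\mu=\int_B E^{\mathcal{A}}f\,d\mu$ for all $B\in\mathcal{A}$. It is assumed that $E^{\mathcal{A}}(|u|)$ is a.e. finite. $E^{\mathcal{A}}M_u$ denotes the operator $f\mapsto E^{\mathcal{A}}(uf)$; when bounded on $L^2(\mathcal{F})$ its adjoint is $M_{\bar u}E^{\mathcal{A}}$. For a measurable function $g$, $S(g)=\{x: g(x)\neq 0\}$ is its support; $\chi_A$ is the indicator of $A$. A closed subspace $M$ reduces a bounded operator $T$ if $TM\subseteq M$ and $T^*M\subseteq M$. All (in)equalities are up to $\mu$-null sets. *)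

(* Defs.v *)
From mathcomp Require Import all_boot all_order all_algebra.
From mathcomp Require Import all_classical all_reals all_analysis.
From mathcomp Require Import measurable_realfun.
Set Implicit Arguments. Unset Strict Implicit. Unset Printing Implicit Defensive.
Import Order.TTheory GRing.Theory Num.Theory.
From mathcomp Require Import complex.
Local Open Scope classical_set_scope.
Local Open Scope ring_scope.

Section Defs.
Context {d : measure_display} {X : measurableType d} {R : realType}.

Definition cmod (z : R[i]) : R := Num.sqrt (complex.Re z ^+ 2 + complex.Im z ^+ 2).
Definition cRe (f : X -> R[i]) : X -> R := fun x => complex.Re (f x).
Definition cIm (f : X -> R[i]) : X -> R := fun x => complex.Im (f x).

Definition cmeasurable (f : X -> R[i]) :=
  measurable_fun setT (cRe f) /\ measurable_fun setT (cIm f).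

Definition is_sub_sigma_algebra (AA : set (set X)) :=
  sigma_algebra setT AA /\ AA `<=` measurable.

Definition sigma_finite_on (AA : set (set X)) (mu : set X -> \bar R) :=
  exists2 F : (set X)^nat, setT = \bigcup_i F i &
    forall i, AA (F i) /\ (mu (F i) < +oo)%E.

Definition Ameasurable {d'} {T : measurableType d'} (AA : set (set X))
  (g : X -> T) := forall B, measurable B -> AA (g @^-1` B).

Variable mu : {measure set X -> \bar R}.

Definition L2 (f : X -> R[i]) :=
  cmeasurable f /\ (\int[mu]_x ((cmod (f x)) ^+ 2)%:E < +oo)%E.
Definition norm2 (f : X -> R[i]) : R :=
  Num.sqrt (fine (\int[mu]_x ((cmod (f x)) ^+ 2)%:E)).

Definition L2_on (A : set X) (f : X -> R[i]) :=
  L2 f /\ {ae mu, forall x, (~` A) x -> f x = 0}.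

Definition condexp_nn (AA : set (set X)) (f g : X -> \bar R) :=
  [/\ Ameasurable AA g, (forall x, (0 <= g x)%E) &
      forall B, AA B -> (\int[mu]_(x in B) f x = \int[mu]_(x in B) g x)%E].

(* (Generalized) conditional expectation of a complex-valued function:
   g = E^AA f iff g is AA-measurable and int_B f = int_B g (real and
   imaginary parts) for every B in AA on which f is integrable (g being
   then integrable on B as well).  For f in L^2(F) this is the usual
   conditional expectation. *)
Definition condexp (AA : set (set X)) (f g : X -> R[i]) :=
  [/\ Ameasurable AA (cRe g), Ameasurable AA (cIm g) &
      forall B, AA B -> (\int[mu]_(x in B) (cmod (f x))%:E < +oo)%E ->
        [/\ (\int[mu]_(x in B) (cmod (g x))%:E < +oo)%E,
            (\int[mu]_(x in B) (cRe f x)%:E = \int[mu]_(x in B) (cRe g x)%:E)%E &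
            (\int[mu]_(x in B) (cIm f x)%:E = \int[mu]_(x in B) (cIm g x)%:E)%E]].

Definition EMu_bounded (AA : set (set X)) (u : X -> R[i]) :=
  exists C : R, forall f, L2 f ->
    (exists g, condexp AA (fun x => u x * f x) g) /\
    forall g, condexp AA (fun x => u x * f x) g -> L2 g /\ norm2 g <= C * norm2 f.

(* L^2(A) reduces T = E^AA M_u:  T L^2(A) <= L^2(A) and T^* L^2(A) <= L^2(A),
   where T^* = M_{conj u} E^AA. *)
Definition reduces_EMu (AA : set (set X)) (u : X -> R[i]) (A : set X) :=
  (forall f, L2_on A f ->
     forall g, condexp AA (fun x => u x * f x) g -> L2_on A g) /\
  (forall f, L2_on A f ->
     forall h, condexp AA f h -> L2_on A (fun x => (u x)^* * h x)).

End Defs.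

(* Main.v *)
Require Import Defs.
From HB Require Import structures.
From mathcomp Require Import all_boot all_order all_algebra.
From mathcomp Require Import all_classical all_reals all_analysis.
From mathcomp Require Import measurable_realfun ring lra.
Import Order.TTheory GRing.Theory Num.Theory.
From mathcomp Require Import complex.
Local Open Scope classical_set_scope.
Local Open Scope ring_scope.

(**
  Write E for the conditional expectation, w = E(|u|^2) and T = E M_u.

  Sufficiency: u vanishes a.e. on {w = 0}, and every f in L^2(A) vanishes a.e.
  on {E(1_A) = 0}; off A almost every point lies in one of these two sets, both
  in the sub-sigma-algebra, so T f and T^* f vanish off A.  That T^* f is square
  integrable follows from |E f| <= E|f|, the L^2-contractivity of E and the
  bound w <= c, obtained by applying T to truncations of conj(u).

  Necessity: let N be the union of the sets {E(1_(A n F_i)) != 0} for F_i of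
  finite measure exhausting X.  A \ N is null.  Applying T^* to
  1_(A n F_i) gives u = 0 on N \ A.  Applying T to truncations of conj(u) 1_A
  gives functions vanishing off A, at least one of which is nonzero at almost
  every point of N where w != 0; hence N n {w != 0} is contained in A, and
  E(1_A) = 1 there.
*)

Set Implicit Arguments.
Unset Strict Implicit.
Unset Printing Implicit Defensive.

(** * Measurability with respect to the sub-sigma-algebra *)

Section sub_sigma_algebra.
Context (d : measure_display) (X : measurableType d) (AA : set (set X)).
Hypothesis sAA : is_sub_sigma_algebra AA.

Local Notation Y := (g_sigma_algebraType AA).

Lemma measurable_subE (B : set X) : measurable (B : set Y) = AA B.
Proof. exact: (congr1 (@^~ B) (measurable_g_measurableTypeE sAA.1)). Qed.

Lemma sub_measurable (B : set X) : AA B -> measurable B.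
Proof. exact: sAA.2. Qed.

(** [AA] is already a sigma-algebra, so the one it generates on [Y] is [AA] itself; closure
    properties of measurable functions thus become available for [Ameasurable]. *)
Lemma AmeasurableP d' (T : measurableType d') (g : X -> T) :
  Ameasurable AA g <-> measurable_fun [set: Y] (g : Y -> T).
Proof.
split => [mg _ B mB|mg B mB]; first by rewrite setTI measurable_subE; exact: mg.
by rewrite -measurable_subE -[X in measurable X]setTI; exact: mg.
Qed.

Lemma Ameasurable_measurable d' (T : measurableType d') (g : X -> T) :
  Ameasurable AA g -> measurable_fun [set: X] g.
Proof. by move=> mg _ B mB; rewrite setTI; apply/sub_measurable/mg. Qed.

Lemma sub_sigma_setT : AA [set: X].
Proof. by rewrite -measurable_subE. Qed.

Lemma sub_sigma_setI B1 B2 : AA B1 -> AA B2 -> AA (B1 `&` B2).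
Proof. by rewrite -!measurable_subE => *; exact: measurableI. Qed.

Lemma sub_sigma_setC B : AA B -> AA (~` B).
Proof. by rewrite -!measurable_subE => *; exact: measurableC. Qed.

Lemma sub_sigma_bigcap (F : (set X)^nat) :
  (forall i, AA (F i)) -> AA (\bigcap_i F i).
Proof.
move=> AF; rewrite -measurable_subE.
by apply: bigcapT_measurable => i; rewrite measurable_subE.
Qed.

End sub_sigma_algebra.

(** * Integrals of nonnegative functions and almost everywhere vanishing *)

Section ae_integral.
Context (R : realType) (d : measure_display) (X : measurableType d).
Variable mu : {measure set X -> \bar R}.
Local Open Scope ereal_scope.

Lemma ae_eq0_integral_le0 (D : set X) (f : X -> \bar R) :
  measurable D -> measurable_fun D f -> (forall x, D x -> 0 <= f x) ->
  \int[mu]_(x in D) f x <= 0 -> {ae mu, forall x, D x -> f x = 0}.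
Proof.
move=> mD mf f0 le0; apply/(ae_eq_integral_abs mu mD mf).
apply/eqP; rewrite eq_le integral_ge0// andbT.
by rewrite (eq_integral f)// => x /[!inE] /f0 /gee0_abs.
Qed.

Lemma integral_eq0_ae (D : set X) (f : X -> \bar R) :
  measurable D -> measurable_fun D f -> (forall x, D x -> 0 <= f x) ->
  {ae mu, forall x, D x -> f x = 0} -> \int[mu]_(x in D) f x = 0.
Proof.
move=> mD mf f0 fae; move: (ae_eq_integral_abs mu mD mf) => [_ /(_ fae) <-].
by apply: eq_integral => x /[!inE] /f0 /gee0_abs.
Qed.

Lemma integralI_indic (D E : set X) (f : X -> \bar R) :
  \int[mu]_(x in D `&` E) f x = \int[mu]_(x in D) ((\1_E x)%:E * f x).
Proof.
rewrite integral_mkcondr; apply: eq_integral => x _.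
by rewrite patchE indicE; case: (x \in E); rewrite ?mul1e ?mul0e.
Qed.

End ae_integral.

(** * Almost everywhere comparison by testing on the sub-sigma-algebra *)

Section comparison.
Context (R : realType) (d : measure_display) (X : measurableType d).
Variables (mu : {measure set X -> \bar R}) (AA : set (set X)).
Hypothesis sAA : is_sub_sigma_algebra AA.
Hypothesis sfAA : sigma_finite_on AA mu.
Local Open Scope ereal_scope.

(** The set {q < p} is covered, up to points discarded by sigma-finiteness and truncation, by
    countably many sets of [AA] on which [q] has finite integral; on each of them p - q is positive
    with integral at most 0, so the set is null. Testing only where [q] is integrable matches what
    [condexp] provides. *)
Lemma sub_ae_le (p q : X -> \bar R) :
  Ameasurable AA p -> Ameasurable AA q -> (forall x, 0 <= q x) ->
  (forall B, AA B -> \int[mu]_(x in B) q x < +oo ->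
     \int[mu]_(x in B) p x <= \int[mu]_(x in B) q x) ->
  {ae mu, forall x, p x <= q x}.
Proof.
move=> Ap Aq q0 pq; have [F FT FA] := sfAA.
have mp := Ameasurable_measurable sAA Ap.
have mq := Ameasurable_measurable sAA Aq.
pose B n i := [set x | q x < p x] `&` [set x | q x <= n%:R%:E] `&` F i.
have AB n i : AA (B n i).
  apply: sub_sigma_setI => //; last exact: (FA i).1.
  apply: sub_sigma_setI => //;
    rewrite -measurable_subE// -[X in measurable X]setTI.
    by apply: emeasurable_fun_lt => //; apply/AmeasurableP.
  by apply: emeasurable_fun_infty_c => //; apply/AmeasurableP.
have mB n i : measurable (B n i) by apply: (sub_measurable sAA); exact: AB.
have B0 n i : {ae mu, forall x, ~ B n i x}.
  have qfin x : B n i x -> q x \is a fin_num.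
    by move=> [[_ /= qn] _]; rewrite ge0_fin_numE// (le_lt_trans qn)// ltry.
  have iq : \int[mu]_(x in B n i) q x < +oo.
    apply: (@le_lt_trans _ _ (\int[mu]_(x in B n i) n%:R%:E)).
      apply: ge0_le_integral => //; first exact: measurable_funTS.
      by move=> x [[]].
    rewrite integral_cst//; apply: lte_mul_pinfty => //.
    apply: le_lt_trans (FA i).2; apply: le_measure; rewrite ?inE//.
      exact: sub_measurable sAA _ (FA i).1.
    exact: subIsetr.
  have mpq : measurable_fun (B n i) (fun x => p x - q x).
    by apply: emeasurable_funB; exact: measurable_funTS.
  have pq0 x : B n i x -> 0 <= p x - q x.
    by move=> Bx; rewrite sube_ge0 ?qfin//; case: Bx => -[] /ltW.
  have : {ae mu, forall x, B n i x -> p x - q x = 0}.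
    apply: ae_eq0_integral_le0 => //.
    have ifin : \int[mu]_(x in B n i) q x \is a fin_num.
      by rewrite ge0_fin_numE// integral_ge0.
    have := pq _ (AB n i) iq.
    (* Both summands are nonnegative on [B n i], so the integral splits and the finite integral of
       [q] cancels. *)
    rewrite (eq_integral (fun x => q x + (p x - q x))); last first.
      by move=> x /[!inE] /qfin qx; rewrite addeC subeK.
    rewrite ge0_integralD//; last exact: measurable_funTS.
    by rewrite -[X in _ <= X -> _]adde0 leeD2lE.
  apply: filterS => x h Bx; have [[/= qp _] _] := Bx.
  by move: qp; rewrite -sube_gt0 (h Bx) ltxx.
have : {ae mu, forall x, forall n i, ~ B n i x}.
  by apply: ae_foralln => n; apply: ae_foralln.
apply: filterS => x nB; rewrite leNgt; apply/negP => qp.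
have [i _ Fix] : (\bigcup_i F i) x by rewrite -FT.
(* Being strictly below [p x], [q x] is finite, hence below some integer. *)
have qfin : q x \is a fin_num by rewrite ge0_fin_numE// (lt_le_trans qp)// leey.
apply: (nB (Num.truncn (fine (q x))).+1 i); split => //; split => //=.
by rewrite -(fineK qfin) lee_fin/= ltW// truncnS_gt.
Qed.

End comparison.

(** * Moving a factor measurable for the sub-sigma-algebra through E *)

Section pullout.
Context (R : realType) (d : measure_display) (X : measurableType d).
Variables (mu : {measure set X -> \bar R}) (AA : set (set X)).
Hypothesis sAA : is_sub_sigma_algebra AA.
Local Open Scope ereal_scope.
Local Notation Y := (g_sigma_algebraType AA).

Import HBNNSimple.

Lemma integral_sub_nnsfunM (a : {nnsfun Y >-> R}) (f : X -> \bar R) :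
  measurable_fun [set: X] f -> (forall x, 0 <= f x) ->
  \int[mu]_x ((a x)%:E * f x) =
  \sum_(r \in range a) (r%:E * \int[mu]_(x in a @^-1` [set r]) f x).
Proof.
move=> mf f0.
have mE r : measurable (a @^-1` [set r] : set X).
  apply: (sub_measurable sAA); rewrite -(measurable_subE sAA).
  exact: measurable_funPTI.
have m1 r : measurable_fun [set: X]
    (fun x => (\1_(a @^-1` [set r]) x)%:E * f x).
  by apply: emeasurable_funM => //; exact/measurable_EFinP/measurable_indic.
transitivity (\int[mu]_x \sum_(r \in range a)
    (r%:E * ((\1_(a @^-1` [set r]) x)%:E * f x))).
  apply: eq_integral => x _; rewrite [in LHS]fimfunE -fsumEFin//.
  rewrite ge0_mule_fsuml; last by move=> r; rewrite nnfun_muleindic_ge0.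
  by apply: eq_fsbigr => r _; rewrite EFinM muleA.
have ge0 r x : 0 <= r%:E * ((\1_(a @^-1` [set r]) x)%:E * f x).
  by rewrite muleA -EFinM mule_ge0// nnfun_muleindic_ge0.
rewrite ge0_integral_fsum//; last by move=> r; exact: measurable_funeM.
apply: eq_fsbigr => r /[!inE] -[y _ <-].
rewrite ge0_integralZl_EFin//; last by move=> x _; rewrite mule_ge0.
by rewrite -integralI_indic setTI.
Qed.

(** For simple [a] the level sets lie in [AA] and the identity is a finite sum of defining ones;
    simple approximation from below and monotone convergence give the general case, infinite values
    included. *)
Lemma condexp_nn_pullout (f k a : X -> \bar R) :
  measurable_fun [set: X] f -> (forall x, 0 <= f x) ->
  condexp_nn mu AA f k -> Ameasurable AA a -> (forall x, 0 <= a x) ->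
  \int[mu]_x (a x * f x) = \int[mu]_x (a x * k x).
Proof.
move=> mf f0 [Ak k0 fk] Aa a0.
have mk := Ameasurable_measurable sAA Ak.
have ma : measurable_fun [set: Y] (a : Y -> \bar R) by exact/AmeasurableP.
pose a_ := nnsfun_approx measurableT ma.
have ma_ n : measurable_fun [set: X] (EFin \o a_ n).
  apply/measurable_EFinP/(Ameasurable_measurable sAA).
  exact/AmeasurableP/measurable_funP.
have lim g : measurable_fun [set: X] g -> (forall x, 0 <= g x) ->
    \int[mu]_x (a x * g x) = limn (fun n => \int[mu]_x ((a_ n x)%:E * g x)).
  move=> mg g0; rewrite -monotone_convergence//.
  - apply: eq_integral => x _; apply/esym/cvg_lim => //.
    have h : EFin \o a_ ^~ x @ \oo --> a x by exact: cvg_nnsfun_approx.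
    (* Multiplication is discontinuous at zero times infinity, so zero factors are treated apart; if
       [a x] is 0, every approximation vanishes at [x]. *)
    have [->|gx0] := eqVneq (g x) 0.
      by under eq_fun do rewrite mule0; rewrite mule0; exact: cvg_cst.
    have [ax0|ax0] := eqVneq (a x) 0.
      rewrite ax0 mul0e; under eq_fun => n.
        suff -> : (a_ n x)%:E = 0 by rewrite mul0e; over.
        apply/eqP; rewrite eq_le; apply/andP; split; last by rewrite lee_fin.
        by rewrite -[leRHS]ax0 /a_ nnsfun_approxE; exact: le_approx.
      exact: cvg_cst.
    apply: cvgeM => //; last exact: cvg_cst.
    by apply: neq0_mule_def; rewrite mule_eq0 negb_or ax0.
  - by move=> n; apply: emeasurable_funM => //; exact: ma_.
  - by move=> n x _; rewrite mule_ge0// lee_fin.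
  - move=> x _ m n mn; apply: lee_wpmul2r => //; rewrite lee_fin.
    by have /lefP := nd_nnsfun_approx measurableT ma mn; apply.
rewrite (lim f)// (lim k)//; congr (limn _); apply/funext => n.
rewrite !integral_sub_nnsfunM//; apply: eq_fsbigr => r _; congr (_ * _).
apply: fk; rewrite -(measurable_subE sAA).
exact: measurable_funPTI.
Qed.
End pullout.

(** * The measures on the sub-sigma-algebra needed for Radon-Nikodym *)

Section restriction.
Context (R : realType) (d : measure_display) (X : measurableType d).
Variables (mu : {measure set X -> \bar R}) (AA : set (set X)).
Local Open Scope ereal_scope.
Local Notation Y := (g_sigma_algebraType AA).

(* The proofs are arguments so that the measure instances below can be inferred
   from the term. *)
Definition restr_sub of is_sub_sigma_algebra AA & sigma_finite_on AA mu :
  set Y -> \bar R := pushforward mu (id : X -> Y).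

Definition density_sub (f : X -> \bar R) of is_sub_sigma_algebra AA
    & measurable_fun [set: X] f & (forall x, 0 <= f x)
    & \int[mu]_x f x < +oo : set Y -> \bar R :=
  fun B => \int[mu]_(x in B) f x.

Hypothesis sAA : is_sub_sigma_algebra AA.

Lemma measurable_id_sub : measurable_fun [set: X] (id : X -> Y).
Proof.
by move=> _ B; rewrite setTI measurable_subE// => /(sub_measurable sAA).
Qed.

Lemma measurable_sub (B : set Y) : measurable B -> measurable (B : set X).
Proof. by rewrite (measurable_subE sAA) => /(sub_measurable sAA). Qed.

Section restr_measure.
Hypothesis sfAA : sigma_finite_on AA mu.
Local Notation muY := (restr_sub sAA sfAA).

Let muY0 : muY set0 = 0. Proof. exact: (measure0 mu). Qed.
Let muY_ge0 B : 0 <= muY B. Proof. exact: (measure_ge0 mu (B : set X)). Qed.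
Let muY_additive : semi_sigma_additive muY.
Proof.
move=> F mF tF mUF; apply: (@measure_semi_sigma_additive _ X R mu F) => //.
  by move=> i; apply: measurable_sub.
exact: measurable_sub.
Qed.

HB.instance Definition _ :=
  isMeasure.Build _ _ _ muY muY0 muY_ge0 muY_additive.

Let muY_sigma_finite : sigma_finite setT muY.
Proof.
have [F FT FA] := sfAA; exists F => // i.
by split; [rewrite measurable_subE//; exact: (FA i).1|exact: (FA i).2].
Qed.

HB.instance Definition _ :=
  @Measure_isSigmaFinite.Build _ _ _ muY muY_sigma_finite.

End restr_measure.

Section density_measure.
Variable f : X -> \bar R.
Hypotheses (mf : measurable_fun [set: X] f) (f0 : forall x, 0 <= f x).
Hypothesis f_fin : \int[mu]_x f x < +oo.
Local Notation nu := (density_sub sAA mf f0 f_fin).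

Let nu0 : nu set0 = 0. Proof. exact: integral_set0. Qed.
Let nu_ge0 B : 0 <= nu B. Proof. exact: integral_ge0. Qed.
Let nu_additive : semi_sigma_additive nu.
Proof.
move=> F mF tF mUF.
apply: (@semi_sigma_additive_nng_induced _ X R mu f) => //.
  by move=> i; apply: measurable_sub.
exact: measurable_sub.
Qed.

HB.instance Definition _ := isMeasure.Build _ _ _ nu nu0 nu_ge0 nu_additive.

Let nu_fin : fin_num_fun nu.
Proof.
move=> B mB; rewrite ge0_fin_numE//; apply: le_lt_trans f_fin.
apply: ge0_subset_integral => //.
exact: measurable_sub.
Qed.

HB.instance Definition _ := @Measure_isFinite.Build _ _ _ nu nu_fin.

End density_measure.

End restriction.

(** * Existence of conditional expectations of nonnegative functions *)

Section existence.
Context (R : realType) (d : measure_display) (X : measurableType d).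
Variables (mu : {measure set X -> \bar R}) (AA : set (set X)).
Hypothesis sAA : is_sub_sigma_algebra AA.
Hypothesis sfAA : sigma_finite_on AA mu.
Local Open Scope ereal_scope.
Local Notation Y := (g_sigma_algebraType AA).

(** [k] is the Radon-Nikodym derivative on [Y] of the measure with density [f], finite by
    integrability, against the restriction of [mu]. *)
Lemma condexp_nn_exists_integrable (f : X -> \bar R) :
  measurable_fun [set: X] f -> (forall x, 0 <= f x) -> \int[mu]_x f x < +oo ->
  exists k, condexp_nn mu AA f k.
Proof.
move=> mf f0 f_fin.
have [|k [k0 kfin ik nuk]] :=
    @radon_nikodym_sigma_finite _ Y R (restr_sub sAA sfAA)
      (density_sub sAA mf f0 f_fin).
  apply/null_content_dominatesP => B.
  rewrite (measurable_subE sAA) => /(sub_measurable sAA) mB muB0.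
  rewrite -[LHS]/(\int[mu]_(x in B) f x).
  apply: null_set_integral => //; first exact: measurable_funTS.
have mk := measurable_int _ ik.
exists k; split => // [|B AB]; first exact/(AmeasurableP sAA).
have mB : measurable (B : set Y) by rewrite measurable_subE.
rewrite -[LHS]/(density_sub sAA mf f0 f_fin B) nuk//.
(* The restricted measure is a pushforward along the identity, so a change of variables returns to
   an integral over [X]. *)
rewrite -[LHS]/(\int[pushforward mu (id : X -> Y)]_(x in B) k x).
rewrite ge0_integral_pushforward//; first exact: measurable_id_sub.
exact: measurable_funTS.
Qed.

(** [X] is cut into disjoint pieces [D n] of finite measure on which f <= n, and the conditional
    expectations of f 1_(D n) are summed. The pieces are in general not in [AA], so it is the
    integrand that is cut, not the test sets. *)
Lemma condexp_nn_exists (f : X -> R) :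
  measurable_fun [set: X] f -> (forall x, (0 <= f x)%R) ->
  exists k, condexp_nn mu AA (EFin \o f) k.
Proof.
move=> mf f0; have mEf : measurable_fun [set: X] (EFin \o f).
  exact/measurable_EFinP.
have /sigma_finiteP[F [FT ndF mF]] : sigma_finite [set: X] mu.
  have [F FT FA] := sfAA; exists F => // i.
  by split; [exact: (sub_measurable sAA (FA i).1)|exact: (FA i).2].
pose G n := [set x | (f x <= n%:R)%R] `&` F n.
have mG n : measurable (G n).
  apply: measurableI; last exact: (mF n).1.
  rewrite -[X in measurable X]setTI.
  exact: emeasurable_fun_infty_c measurableT mEf n%:R%:E.
pose D := seqDU G.
have mD n : measurable (D n) by exact: seqDU_measurable.
have DG n : D n `<=` G n by exact: subset_seqDU.
have DT : \bigcup_n D n = [set: X].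
  rewrite -seqDU_bigcup_eq; apply/seteqP; split => // x _.
  have [i _ Fix] : (\bigcup_i F i) x by rewrite -FT.
  (* The index is large enough for both conditions: it bounds [f x], and monotonicity of [F] keeps
     [x] in the later set. *)
  exists (maxn i (Num.truncn (f x)).+1) => //; split => /=.
    by rewrite (le_trans (ltW (truncnS_gt _)))// ler_nat leq_maxr.
  by have /subsetPset := ndF _ _ (leq_maxl i (Num.truncn (f x)).+1); apply.
have mfD n : measurable_fun [set: X] (fun x => (\1_(D n) x)%:E * (f x)%:E).
  by apply: emeasurable_funM => //; exact/measurable_EFinP/measurable_indic.
have fD0 n x : 0 <= (\1_(D n) x)%:E * (f x)%:E :> \bar R.
  by rewrite mule_ge0 ?lee_fin.
have : forall n, exists k,
    condexp_nn mu AA (fun x => (\1_(D n) x)%:E * (f x)%:E) k.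
  move=> n; apply: condexp_nn_exists_integrable => //.
  rewrite -integralI_indic setTI.
  apply: (@le_lt_trans _ _ (\int[mu]_(x in D n) n%:R%:E)).
    apply: ge0_le_integral => //; [|exact: measurable_funTS|].
      by move=> x _; rewrite lee_fin.
    by move=> x /DG[+ _]; rewrite lee_fin.
  rewrite integral_cst//; apply: lte_mul_pinfty => //.
  apply: le_lt_trans (mF n).2; apply: le_measure; rewrite ?inE//.
    exact: (mF n).1.
  by move=> x /DG[].
move=> /choice[k hk].
have k0 n x : 0 <= k n x by have [_ + _] := hk n; apply.
exists (fun x => \sum_(n <oo) k n x); split.
- apply/(AmeasurableP sAA); apply: ge0_emeasurable_sum => [n x _ _|n _].
    exact: k0.
  by have [+ _ _] := hk n => /(AmeasurableP sAA).
- by move=> x; apply: nneseries_ge0 => n _ _; exact: k0.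
- move=> B AB; have mB := sub_measurable sAA AB.
  rewrite integral_nneseries//; last first.
    move=> n; apply: measurable_funTS.
    by have [+ _ _] := hk n => /(Ameasurable_measurable sAA).
  transitivity (\int[mu]_(x in \bigcup_n (B `&` D n)) (EFin \o f) x).
    by rewrite -setI_bigcupr DT setIT.
  rewrite ge0_integral_bigcup//; last 4 first.
  + by move=> n; exact: measurableI.
  + exact: measurable_funTS.
  + by move=> x _; rewrite lee_fin.
  + by apply: trivIset_setIl; exact: trivIset_seqDU.
  apply: eq_eseriesr => n _; rewrite integralI_indic.
  by have [_ _ ->] := hk n.
Qed.

End existence.

(** * The modulus of complex numbers *)

Section cmod.
Context (R : realType).
Implicit Types z w : R[i].

Lemma cmod_normE z : `|z| = (cmod z)%:C%C.
Proof. exact: normc_def. Qed.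

Lemma cmod_ge0 z : 0 <= cmod z.
Proof. exact: sqrtr_ge0. Qed.

Lemma cmod_sqr z : cmod z ^+ 2 = complex.Re z ^+ 2 + complex.Im z ^+ 2.
Proof. by rewrite sqr_sqrtr// addr_ge0// sqr_ge0. Qed.

Lemma cmodM z w : cmod (z * w) = cmod z * cmod w.
Proof.
by apply: (@complexI R); rewrite -cmod_normE normrM !cmod_normE rmorphM.
Qed.

Lemma cmod_conj z : cmod z^* = cmod z.
Proof. by rewrite /cmod; case: z => a b /=; rewrite sqrrN. Qed.

Lemma cmod_real (a : R) : 0 <= a -> cmod a%:C%C = a.
Proof. by move=> a0; rewrite /cmod /= expr0n addr0 sqrtr_sqr ger0_norm. Qed.

Lemma cmod_eq0 z : (cmod z == 0) = (z == 0).
Proof. by rewrite -(normr_eq0 z) cmod_normE -(inj_eq (@complexI R)). Qed.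

Lemma cmod0 : cmod (0 : R[i]) = 0.
Proof. by apply/eqP; rewrite cmod_eq0. Qed.

Lemma normr_Re_le_cmod z : `|complex.Re z| <= cmod z.
Proof. by rewrite -sqrtr_sqr ler_wsqrtr// lerDl sqr_ge0. Qed.

Lemma normr_Im_le_cmod z : `|complex.Im z| <= cmod z.
Proof. by rewrite -sqrtr_sqr ler_wsqrtr// lerDr sqr_ge0. Qed.

Lemma mul_conj_cmod z : z * z^* = (cmod z ^+ 2)%:C%C.
Proof. by rewrite -normCK cmod_normE rmorphXn. Qed.

End cmod.

(** * Measurability of complex-valued functions *)

Section cmeasurable.
Context (R : realType) (d : measure_display) (X : measurableType d).
Implicit Types f g : X -> R[i].

Lemma cmeasurable_cmod f :
  cmeasurable f -> measurable_fun [set: X] (fun x => cmod (f x)).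
Proof.
move=> [mr mi]; apply: measurableT_comp => //.
  exact: (continuous_measurable_fun (@sqrt_continuous R)).
by apply: measurable_funD; exact: measurable_funX.
Qed.

Lemma cmeasurable_sqr f :
  cmeasurable f -> measurable_fun [set: X] (fun x => (cmod (f x) ^+ 2)%:E).
Proof.
by move=> /cmeasurable_cmod mf; apply/measurable_EFinP/measurable_funX.
Qed.

Lemma cmeasurableM f g :
  cmeasurable f -> cmeasurable g -> cmeasurable (fun x => f x * g x).
Proof.
move=> [fr fi] [gr gi]; split.
  rewrite (_ : cRe _ = (fun x => cRe f x * cRe g x - cIm f x * cIm g x)).
    by apply: measurable_funB; exact: measurable_funM.
  by apply/funext => x; rewrite /cRe /cIm; case: (f x) (g x) => [a b] [].
rewrite (_ : cIm _ = (fun x => cRe f x * cIm g x + cIm f x * cRe g x)).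
  by apply: measurable_funD; exact: measurable_funM.
by apply/funext => x; rewrite /cRe /cIm; case: (f x) (g x) => [a b] [].
Qed.

Lemma cmeasurable_conj f : cmeasurable f -> cmeasurable (fun x => (f x)^*).
Proof.
move=> [fr fi]; split.
  rewrite (_ : cRe _ = cRe f)//.
  by apply/funext => x; rewrite /cRe; case: (f x).
rewrite (_ : cIm _ = (fun x => - cIm f x)); first exact: measurable_funN.
by apply/funext => x; rewrite /cIm; case: (f x).
Qed.

Lemma cmeasurable_real (a : X -> R) :
  measurable_fun [set: X] a -> cmeasurable (fun x => (a x)%:C%C).
Proof. by move=> ma; split => //; exact: measurable_cst. Qed.

End cmeasurable.

(** * Domination and vanishing of conditional expectations *)

Section conditional_expectation.
Context (R : realType) (d : measure_display) (X : measurableType d).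
Variables (mu : {measure set X -> \bar R}) (AA : set (set X)).
Hypothesis sAA : is_sub_sigma_algebra AA.
Hypothesis sfAA : sigma_finite_on AA mu.
Local Open Scope ereal_scope.
Local Notation Y := (g_sigma_algebraType AA).

(** Integrability of [f] makes [k] finite almost everywhere, so replacing +oo by 0 through [fine]
    changes no integral. *)
Lemma condexp_nn_condexp (f : X -> R) (k : X -> \bar R) :
  measurable_fun [set: X] f -> (forall x, (0 <= f x)%R) ->
  \int[mu]_x (f x)%:E < +oo -> condexp_nn mu AA (EFin \o f) k ->
  condexp mu AA (fun x => (f x)%:C%C) (fun x => (fine (k x))%:C%C).
Proof.
move=> mf f0 f_fin [Ak k0 fk].
have mk := Ameasurable_measurable sAA Ak.
have Afk : Ameasurable AA (fun x => fine (k x)).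
  apply/(AmeasurableP sAA); apply: measurableT_comp => //.
  exact/(AmeasurableP sAA).
have mfk := Ameasurable_measurable sAA Afk.
have kfin : {ae mu, forall x, [set: X] x -> k x \is a fin_num}.
  apply: integrable_ae => //; apply/integrableP; split => //.
  under eq_integral do rewrite gee0_abs//.
  by rewrite -fk//; exact: sub_sigma_setT.
have intk B : AA B ->
    \int[mu]_(x in B) (fine (k x))%:E = \int[mu]_(x in B) (f x)%:E.
  move=> AB; have mB := sub_measurable sAA AB.
  rewrite [RHS]fk//; apply: ge0_ae_eq_integral => //.
  - by apply/measurable_EFinP; exact: measurable_funTS.
  - exact: measurable_funTS.
  - by move=> x _; rewrite lee_fin fine_ge0.
  - by apply: filterS kfin => x /(_ I) kx _; rewrite fineK.
split => //.
- apply/(AmeasurableP sAA); exact: measurable_cst.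
- move=> B AB _; split; last 2 first.
  + by rewrite /cRe/= intk.
  + by rewrite /cIm/=.
  under eq_integral do rewrite cmod_real ?fine_ge0//.
  rewrite intk//; apply: le_lt_trans f_fin.
  apply: ge0_subset_integral => //; first exact: sub_measurable AB.
    exact/measurable_EFinP.
  by move=> x _; rewrite lee_fin.
Qed.

(** Both [h] and its opposite are compared with [k] by [sub_ae_le]: on the test sets [b] and [k]
    have the same finite integral, so [f] and [h] are integrable there. The real-valued form serves
    real and imaginary parts alike. *)
Lemma ae_normr_le_condexp_nn (f h : X -> R) (b : X -> R) (k : X -> \bar R) :
  measurable_fun [set: X] f -> measurable_fun [set: X] b ->
  (forall x, (`|f x| <= b x)%R) -> condexp_nn mu AA (EFin \o b) k ->
  Ameasurable AA h ->
  (forall B, AA B -> \int[mu]_(x in B) (b x)%:E < +oo ->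
     \int[mu]_(x in B) `|(h x)%:E| < +oo /\
     \int[mu]_(x in B) (f x)%:E = \int[mu]_(x in B) (h x)%:E) ->
  {ae mu, forall x, `|(h x)%:E| <= k x}.
Proof.
move=> mf mb fb [Ak k0 bk] Ah fh.
have mh := Ameasurable_measurable sAA Ah.
have b0 x : (0 <= b x)%R by exact: le_trans (fb x).
have fi B : AA B -> \int[mu]_(x in B) (b x)%:E < +oo ->
    [/\ mu.-integrable B (EFin \o f), mu.-integrable B (EFin \o b) &
        mu.-integrable B (EFin \o h)].
  move=> AB bfin; have mB := sub_measurable sAA AB.
  have ib : mu.-integrable B (EFin \o b).
    apply/integrableP; split.
      by apply/measurable_EFinP; exact: measurable_funTS.
    by under eq_integral do rewrite /= ger0_norm//.
  split => //.
    apply: le_integrable ib => //.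
      by apply/measurable_EFinP; exact: measurable_funTS.
    by move=> x _; rewrite /= lee_fin (ger0_norm (b0 x)).
  apply/integrableP; split; last by have [] := fh _ AB bfin.
  by apply/measurable_EFinP; exact: measurable_funTS.
have le1 : {ae mu, forall x, (h x)%:E <= k x}.
  apply: (sub_ae_le sAA sfAA) => //.
    apply/(AmeasurableP sAA)/measurable_EFinP; exact/(AmeasurableP sAA).
  move=> B AB; rewrite -bk// => bfin; have [_ <-] := fh _ AB bfin.
  have [If Ib _] := fi _ AB bfin.
  apply: le_integral => //; first exact: (sub_measurable sAA).
  by move=> x _; rewrite lee_fin (le_trans (ler_norm _)).
have le2 : {ae mu, forall x, (- h x)%:E <= k x}.
  apply: (sub_ae_le sAA sfAA) => //.
    apply/(AmeasurableP sAA)/measurable_EFinP/measurable_funN.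
    exact/(AmeasurableP sAA).
  move=> B AB; rewrite -bk// => bfin; have [_ fhB] := fh _ AB bfin.
  have [If Ib Ih] := fi _ AB bfin.
  under eq_integral do rewrite EFinN.
  have mB := sub_measurable sAA AB.
  rewrite integralN; last exact: (integrable_add_def _ (f := EFin \o h)).
  rewrite -fhB -integralN; last exact: (integrable_add_def _ (f := EFin \o f)).
  apply: le_integral => //; first exact: integrableN.
  by move=> x _; rewrite -EFinN lee_fin (le_trans (ler_norm _))// normrN.
by apply: filterS2 le1 le2 => x h1 h2; rewrite abse_EFin; case: (ler0P (h x)).
Qed.

(** The previous bound with b = |f|, applied to each part. This componentwise form of |E f| <= E|f|
    loses a factor sqrt 2, which is harmless for vanishing and square integrability. *)
Lemma condexp_le_condexp_nn (f h : X -> R[i]) (k : X -> \bar R) :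
  cmeasurable f -> condexp mu AA f h ->
  condexp_nn mu AA (fun x => (cmod (f x))%:E) k ->
  {ae mu, forall x, (`|cRe h x|%:E <= k x) /\ (`|cIm h x|%:E <= k x)}.
Proof.
move=> mf [Ahr Ahi fh] fk; have [mfr mfi] := mf.
have mc := cmeasurable_cmod mf.
have hfin B (g : X -> R) : AA B -> measurable_fun [set: X] g ->
    (forall x, (`|g x| <= cmod (h x))%R) ->
    \int[mu]_(x in B) (cmod (h x))%:E < +oo ->
    \int[mu]_(x in B) `|(g x)%:E| < +oo.
  move=> AB mg gh; apply: le_lt_trans.
  have mh : cmeasurable h.
    by split; [exact: Ameasurable_measurable Ahr
              |exact: Ameasurable_measurable Ahi].
  apply: ge0_le_integral => //.
  - exact: (sub_measurable sAA).
  - apply: measurableT_comp => //; apply/measurable_EFinP.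
    exact: measurable_funTS.
  - by apply/measurable_EFinP/measurable_funTS/cmeasurable_cmod.
  - by move=> x _; rewrite lee_fin.
have re : {ae mu, forall x, `|(cRe h x)%:E| <= k x}.
  apply: (ae_normr_le_condexp_nn mfr mc _ fk Ahr).
    by move=> x; exact: normr_Re_le_cmod.
  move=> B AB /(fh _ AB)[hB -> _]; split => //; apply: hfin hB => //.
    exact: (Ameasurable_measurable sAA).
  by move=> x; exact: normr_Re_le_cmod.
have im : {ae mu, forall x, `|(cIm h x)%:E| <= k x}.
  apply: (ae_normr_le_condexp_nn mfi mc _ fk Ahi).
    by move=> x; exact: normr_Im_le_cmod.
  move=> B AB /(fh _ AB)[hB _ ->]; split => //; apply: hfin hB => //.
    exact: (Ameasurable_measurable sAA).
  by move=> x; exact: normr_Im_le_cmod.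
exact: filterS2 re im.
Qed.

(** E|f| has zero integral over [B], hence vanishes almost everywhere there, and it dominates both
    parts of [h]. *)
Lemma condexp_eq0 (f h : X -> R[i]) (B : set X) :
  cmeasurable f -> condexp mu AA f h -> AA B ->
  {ae mu, forall x, B x -> f x = 0%R} -> {ae mu, forall x, B x -> h x = 0%R}.
Proof.
move=> mf fh AB f0; have mc := cmeasurable_cmod mf.
have [k fk] := condexp_nn_exists sAA sfAA mc (fun x => cmod_ge0 (f x)).
have mB := sub_measurable sAA AB.
have {}hk := condexp_le_condexp_nn mf fh fk.
have [Ak k0 kint] := fk.
have kB0 : {ae mu, forall x, B x -> k x = 0}.
  apply: ae_eq0_integral_le0 => //.
    exact/measurable_funTS/(Ameasurable_measurable sAA).
  rewrite -kint// integral_eq0_ae//.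
  - exact/measurable_EFinP/measurable_funTS.
  - by move=> x _; rewrite lee_fin cmod_ge0.
  - by apply: filterS f0 => x /[apply] fx; rewrite /= fx cmod0.
apply: filterS2 hk kB0 => x [hr hi] /[apply] kx.
move: hr hi; rewrite kx !lee_fin !normr_le0 /cRe /cIm.
by case: (h x) => a b /= /eqP -> /eqP ->.
Qed.

End conditional_expectation.

(** * Contraction of the L^2 norm for nonnegative functions *)

Section square_integrability.
Context (R : realType) (d : measure_display) (X : measurableType d).
Variables (mu : {measure set X -> \bar R}) (AA : set (set X)).
Hypothesis sAA : is_sub_sigma_algebra AA.
Hypothesis sfAA : sigma_finite_on AA mu.
Local Open Scope ereal_scope.

(** Working with the restricted measure keeps the increasing sets inside [AA]. *)
Lemma sigma_finite_on_nd : exists F : (set X)^nat,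
  [/\ [set: X] = \bigcup_i F i, nondecreasing_seq F &
      forall i, AA (F i) /\ mu (F i) < +oo].
Proof.
have /sigma_finiteP[F [FT ndF FA]] := sigma_finiteT (restr_sub sAA sfAA).
exists F; split => // i.
by split; [rewrite -(measurable_subE sAA); exact: (FA i).1|exact: (FA i).2].
Qed.

(* Truncating k to a finite b <= k, 2 \int b^2 <= 2 \int b k = 2 \int b f
   <= \int b^2 + \int f^2. *)
Lemma condexp_nn_sqr_le (f : X -> R) (k : X -> \bar R) :
  measurable_fun [set: X] f -> (forall x, (0 <= f x)%R) ->
  condexp_nn mu AA (EFin \o f) k ->
  \int[mu]_x (k x * k x) <= \int[mu]_x (f x ^+ 2)%:E.
Proof.
move=> mf f0 fk; have [Ak k0 _] := fk.
have mk := Ameasurable_measurable sAA Ak.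
have [F [FT ndF FA]] := sigma_finite_on_nd.
have mF i : measurable (F i) := sub_measurable sAA (FA i).1.
(* Cutting at height n and to [F n] makes [b n] square integrable while keeping it [AA]-measurable,
   as the pull-out identity requires. *)
pose b n x : R := (fine (mine (k x) n%:R%:E) * \1_(F n) x)%R.
have bE n x : b n x =
    ((if k x is r%:E then Num.min r n%:R else n%:R) * \1_(F n) x)%R.
  rewrite /b; move: (k0 x); case: (k x) => [r| |//] _; last by rewrite minye.
  by rewrite -EFin_min.
have b0 n x : (0 <= b n x)%R.
  rewrite bE mulr_ge0//; move: (k0 x); case: (k x) => [r| |] // r0.
  by rewrite le_min -lee_fin r0 /=.
have bk n x : (b n x)%:E <= k x.
  have m1 : (\1_(F n) x <= 1 :> R)%R by rewrite indicE lern1; case: (_ \in _).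
  rewrite bE; move: (k0 x); case: (k x) => [r| |] // r0; last exact: leey.
  rewrite lee_fin (le_trans (ler_wpM2l _ m1))//.
    by rewrite le_min -lee_fin r0 /=.
  by rewrite mulr1 ge_min lexx.
have bn n x : (b n x <= n%:R * \1_(F n) x)%R.
  rewrite bE ler_wpM2r//; case: (k x) => // r.
  by rewrite ge_min lexx orbT.
have bnd m n x : (m <= n)%N -> (b m x <= b n x)%R.
  move=> mn; rewrite !bE ler_pM//.
  - move: (k0 x); case: (k x) => [r| |] // r0.
    by rewrite le_min -lee_fin r0 /=.
  - case: (k x) => [r| |]; rewrite ?ler_nat//.
    by rewrite le_min !ge_min lexx ler_nat mn orbT.
  - rewrite !indicE ler_nat; have [|] := boolP (x \in F m) => //.
    rewrite inE => Fmx; rewrite mem_set//.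
    by have /subsetPset := ndF _ _ mn; apply.
have Ab n : Ameasurable AA (EFin \o b n).
  apply/(AmeasurableP sAA)/measurable_EFinP/measurable_funM.
    apply: measurableT_comp => //; apply: measurable_mine => //.
    exact/(AmeasurableP sAA).
  by apply: measurable_indic; rewrite measurable_subE//; exact: (FA n).1.
clearbody b.
have mb n : measurable_fun [set: X] (b n).
  exact/measurable_EFinP/(Ameasurable_measurable sAA)/Ab.
have mb2 n : measurable_fun [set: X] (fun x => (b n x ^+ 2)%:E).
  exact/measurable_EFinP/measurable_funX.
have mf2 : measurable_fun [set: X] (fun x => (f x ^+ 2)%:E).
  exact/measurable_EFinP/measurable_funX.
have key n : \int[mu]_x (b n x ^+ 2)%:E <= \int[mu]_x (f x ^+ 2)%:E.
  have bfin : \int[mu]_x (b n x ^+ 2)%:E \is a fin_num.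
    rewrite ge0_fin_numE; last first.
      by apply: integral_ge0 => x _; rewrite lee_fin sqr_ge0.
    apply: (@le_lt_trans _ _ (\int[mu]_(x in F n) (n%:R ^+ 2)%:E)).
      rewrite -[F n]setTI integralI_indic; apply: ge0_le_integral => //.
      - by move=> x _; rewrite lee_fin sqr_ge0.
      - apply: emeasurable_funM => //.
        exact/measurable_EFinP/measurable_indic.
      - move=> x _; rewrite -EFinM lee_fin.
        apply: (@le_trans _ _ ((n%:R * \1_(F n) x) ^+ 2)%R).
          by rewrite lerXn2r ?nnegrE ?mulr_ge0.
        rewrite exprMn mulrC ler_wpM2r ?sqr_ge0// indicE -natrX.
        by case: (_ \in _).
    rewrite integral_cst//; apply: lte_mul_pinfty => //.
    exact: (FA n).2.
  have h1 : \int[mu]_x (b n x ^+ 2)%:E <= \int[mu]_x (b n x * f x)%:E.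
    have mEf : measurable_fun [set: X] (EFin \o f) by exact/measurable_EFinP.
    have := condexp_nn_pullout sAA mEf _ fk (Ab n).
    move=> /(_ _ _)/= -> //; last by move=> x; rewrite lee_fin.
    apply: ge0_le_integral => //.
    - by move=> x _; rewrite lee_fin sqr_ge0.
    - by apply: emeasurable_funM => //; exact/measurable_EFinP.
    - by move=> x _; rewrite expr2 EFinM lee_wpmul2l// lee_fin.
  have h2 : 2%:E * \int[mu]_x (b n x * f x)%:E <=
      \int[mu]_x (b n x ^+ 2)%:E + \int[mu]_x (f x ^+ 2)%:E.
    rewrite -ge0_integralZl_EFin//; last 2 first.
    - by move=> x _; rewrite lee_fin mulr_ge0.
    - exact/measurable_EFinP/measurable_funM.
    rewrite -ge0_integralD//; last 2 first.
    - by move=> x _; rewrite lee_fin sqr_ge0.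
    - by move=> x _; rewrite lee_fin sqr_ge0.
    apply: ge0_le_integral => //.
    - by move=> x _; rewrite lee_fin !mulr_ge0.
    - by apply: measurable_funeM; exact/measurable_EFinP/measurable_funM.
    - exact: emeasurable_funD.
    - move=> x _; rewrite -EFinM -EFinD lee_fin -subr_ge0.
      by rewrite (_ : _ - _ = (b n x - f x) ^+ 2)%R ?sqr_ge0//; ring.
  (* One copy of the integral of b^2, finite by [bfin], is added to both sides. *)
  rewrite -(leeD2lE _ _ bfin); apply: le_trans h2.
  by rewrite -mule2n -mule_natl; apply: lee_wpmul2l.
have lim x : (b n x ^+ 2)%:E @[n --> \oo] --> k x * k x.
  have [i _ Fix] : (\bigcup_i F i) x by rewrite -FT.
  have F1 n : (i <= n)%N -> \1_(F n) x = 1%R :> R.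
    move=> ni; rewrite indicE mem_set//.
    by have /subsetPset := ndF _ _ ni; apply.
  have cb : (b n x)%:E @[n --> \oo] --> k x.
    (* A finite [k x] is attained for all large n; if [k x] is +oo, the sequence is eventually n. *)
    have := k0 x; case E : (k x) => [r| |] // r0.
      apply: cvg_near_cst; near=> n; congr EFin; rewrite bE E F1; last first.
        by near: n; exact: nbhs_infty_ge.
      rewrite mulr1; apply/min_idPl; near: n; exact: nbhs_infty_ger.
    apply: (@cvg_trans _ (n%:R%:E @[n --> \oo])); last exact/cvgeryP/cvgr_idn.
    apply: near_eq_cvg; near=> n; congr EFin; rewrite bE E F1 ?mulr1//.
    by near: n; exact: nbhs_infty_ge.
  under eq_fun do rewrite expr2 EFinM.
  apply: cvgeM => //; case: (k x) => [r| |] //.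
rewrite (_ : \int[mu]_x (k x * k x) =
  limn (fun n => \int[mu]_x (b n x ^+ 2)%:E)).
  apply: lime_le; last exact: nearW.
  apply: ereal_nondecreasing_is_cvgn => m n mn; apply: ge0_le_integral => //.
    by move=> x _; rewrite lee_fin sqr_ge0.
  by move=> x _; rewrite lee_fin lerXn2r ?nnegrE// bnd.
rewrite -monotone_convergence//.
- by apply: eq_integral => x _; apply/esym/cvg_lim.
- by move=> n x _; rewrite lee_fin sqr_ge0.
- by move=> x _ m n mn; rewrite lee_fin lerXn2r ?nnegrE// bnd.
Unshelve. all: by end_near. Qed.

End square_integrability.

(** * Consequences of the boundedness of E M_u *)

Section bounded.
Context (R : realType) (d : measure_display) (X : measurableType d).
Variables (mu : {measure set X -> \bar R}) (AA : set (set X)) (u : X -> R[i]).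
Hypothesis sAA : is_sub_sigma_algebra AA.
Hypothesis sfAA : sigma_finite_on AA mu.
Hypothesis u_meas : cmeasurable u.
Hypothesis u_bounded : EMu_bounded mu AA u.
Local Open Scope ereal_scope.

(** The norm bound is squared, both integrals being finite. Adding 1 to C^2 makes the constant
    positive, so that it can be divided by later. *)
Lemma EMu_bounded_sqr : exists2 c : R, (0 < c)%R & forall f g, L2 mu f ->
  condexp mu AA (fun x => u x * f x)%R g ->
  L2 mu g /\
  \int[mu]_x ((cmod (g x)) ^+ 2)%:E <= c%:E * \int[mu]_x ((cmod (f x)) ^+ 2)%:E.
Proof.
have [C HC] := u_bounded; exists (C ^+ 2 + 1)%R.
  by rewrite ltr_wpDl ?sqr_ge0.
move=> f g Lf fg; have [_ /(_ _ fg)[Lg gf]] := HC _ Lf; split => //.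
have sq0 (h : X -> R[i]) : 0 <= \int[mu]_x ((cmod (h x)) ^+ 2)%:E.
  by apply: integral_ge0 => x _; rewrite lee_fin sqr_ge0.
have fin h : L2 mu h -> \int[mu]_x ((cmod (h x)) ^+ 2)%:E \is a fin_num.
  by move=> [_ ?]; rewrite ge0_fin_numE.
rewrite -(fineK (fin _ Lf)) -(fineK (fin _ Lg)) -EFinM lee_fin.
move: gf; rewrite /norm2.
set a := fine (\int[mu]_x (cmod (f x) ^+ 2)%:E).
set b := fine (\int[mu]_x (cmod (g x) ^+ 2)%:E).
have a0 : (0 <= a)%R by exact: fine_ge0.
have b0 : (0 <= b)%R by exact: fine_ge0.
move=> ba; rewrite -(sqr_sqrtr b0) -[X in (_ <= _ * X)%R](sqr_sqrtr a0).
apply: (@le_trans _ _ ((C * Num.sqrt a) ^+ 2)%R).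
  (* [C] has no prescribed sign, but the product dominates a square root. *)
  have Ca0 := le_trans (sqrtr_ge0 _) ba.
  by rewrite lerXn2r ?nnegrE ?sqrtr_ge0.
by rewrite exprMn mulrDl mul1r lerDl sqr_ge0.
Qed.

(* Test functions: u * conj_trunc E = |u|^2 1_E. *)
Definition conj_trunc (E : set X) x : R[i] := ((u x)^* * (\1_E x)%:C%C)%R.

Lemma cmeasurable_conj_trunc E : measurable E -> cmeasurable (conj_trunc E).
Proof.
move=> mE; apply: cmeasurableM; first exact: cmeasurable_conj.
by apply: cmeasurable_real; exact: measurable_indic.
Qed.

Lemma mul_conj_trunc E :
  (fun x => u x * conj_trunc E x)%R =
  (fun x => (cmod (u x) ^+ 2 * \1_E x)%:C%C).
Proof.
by apply/funext => x; rewrite /conj_trunc mulrA mul_conj_cmod -rmorphM.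
Qed.

Lemma cmod_conj_trunc E x :
  (cmod (conj_trunc E x) ^+ 2 = cmod (u x) ^+ 2 * \1_E x)%R.
Proof.
rewrite /conj_trunc cmodM cmod_conj cmod_real// exprMn.
by rewrite indicE; case: (_ \in _); rewrite ?expr1n ?expr0n.
Qed.

Lemma integral_sqr_indic E B :
  \int[mu]_(x in B) (cmod (u x) ^+ 2 * \1_E x)%:E =
  \int[mu]_(x in B `&` E) (cmod (u x) ^+ 2)%:E.
Proof.
by rewrite integralI_indic; apply: eq_integral => x _; rewrite EFinM muleC.
Qed.

Lemma L2_conj_trunc E : measurable E ->
  \int[mu]_(x in E) (cmod (u x) ^+ 2)%:E < +oo -> L2 mu (conj_trunc E).
Proof.
move=> mE fin; split; first exact: cmeasurable_conj_trunc.
under eq_integral do rewrite cmod_conj_trunc.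
by rewrite integral_sqr_indic setTI.
Qed.

(** By [mul_conj_trunc] the function to be averaged is nonnegative, and it is integrable by
    assumption, so its nonnegative conditional expectation [v] also yields the complex one. *)
Lemma condexp_conj_trunc E : measurable E ->
  \int[mu]_(x in E) (cmod (u x) ^+ 2)%:E < +oo ->
  exists2 v : X -> \bar R,
    condexp_nn mu AA (fun x => (cmod (u x) ^+ 2 * \1_E x)%:E) v &
    condexp mu AA (fun x => u x * conj_trunc E x)%R
      (fun x => (fine (v x))%:C%C).
Proof.
move=> mE fin.
have mf : measurable_fun [set: X] (fun x => cmod (u x) ^+ 2 * \1_E x)%R.
  apply: measurable_funM; last exact: measurable_indic.
  exact/measurable_funX/cmeasurable_cmod.
have f0 x : (0 <= cmod (u x) ^+ 2 * \1_E x)%R by rewrite mulr_ge0 ?sqr_ge0.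
have [v hv] := condexp_nn_exists sAA sfAA mf f0; exists v => //.
rewrite mul_conj_trunc; apply: condexp_nn_condexp => //.
by rewrite integral_sqr_indic setTI.
Qed.

Lemma integral_sqr_trunc_fin (n : nat) (E : set X) :
  measurable E -> mu E < +oo -> (forall x, E x -> (cmod (u x) <= n%:R)%R) ->
  \int[mu]_(x in E) (cmod (u x) ^+ 2)%:E < +oo.
Proof.
move=> mE Efin un.
apply: (@le_lt_trans _ _ (\int[mu]_(x in E) (n%:R ^+ 2)%:E)).
  apply: ge0_le_integral => //.
  - by move=> x _; rewrite lee_fin sqr_ge0.
  - exact/measurable_funTS/cmeasurable_sqr.
  - by move=> x Ex; rewrite lee_fin lerXn2r ?nnegrE ?cmod_ge0// un.
by rewrite integral_cst//; exact: lte_mul_pinfty.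
Qed.

(** Integrability of |u|^2 on sets of finite measure is not known beforehand; it does hold on these
    subsets, which increase to [B]. *)
Definition trunc_set (B : set X) (n : nat) : set X :=
  B `&` [set x | (cmod (u x) <= n%:R)%R].

Lemma measurable_trunc_set B n : measurable B -> measurable (trunc_set B n).
Proof.
move=> mB; apply: measurableI => //; rewrite -[X in measurable X]setTI.
have mc : measurable_fun [set: X] (fun x => (cmod (u x))%:E).
  exact/measurable_EFinP/cmeasurable_cmod.
exact: emeasurable_fun_infty_c measurableT mc n%:R%:E.
Qed.

Lemma trunc_set_fin B n : measurable B -> mu B < +oo ->
  \int[mu]_(x in trunc_set B n) (cmod (u x) ^+ 2)%:E < +oo.
Proof.
move=> mB Bfin; have mE := measurable_trunc_set n mB.
apply: (@integral_sqr_trunc_fin n) => //; last by move=> x [].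
by apply: le_lt_trans Bfin; apply: le_measure; rewrite ?inE//; exact: subIsetl.
Qed.

Lemma trunc_set_nd B : nondecreasing_seq (trunc_set B).
Proof.
move=> m n mn; apply/subsetPset => x [Bx /= um]; split => //=.
by rewrite (le_trans um)// ler_nat.
Qed.

Lemma bigcup_trunc_set B : \bigcup_n trunc_set B n = B.
Proof.
apply/seteqP; split => [x [n _ []]//|x Bx].
exists (Num.truncn (cmod (u x))).+1 => //; split => //=.
by rewrite ltW// truncnS_gt.
Qed.

(* With v = E(|u|^2 1_E), E a truncation of B, and I = \int_B v, boundedness
   gives \int v^2 <= c I, and 2 c v <= v^2 + c^2 then yields I <= c mu(B). *)
Lemma integral_sqr_le : exists2 c : R, (0 < c)%R & forall B, AA B ->
  mu B < +oo -> \int[mu]_(x in B) (cmod (u x) ^+ 2)%:E <= c%:E * mu B.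
Proof.
have [c c0 Hc] := EMu_bounded_sqr; exists c => // B AB Bfin.
have mB := sub_measurable sAA AB.
have mu2 := cmeasurable_sqr u_meas.
have key n : \int[mu]_(x in trunc_set B n) (cmod (u x) ^+ 2)%:E <= c%:E * mu B.
  have mE := measurable_trunc_set n mB.
  have Efin := trunc_set_fin n mB Bfin.
  have [v [Av v0 vE] hv] := condexp_conj_trunc mE Efin.
  have [_ vI] := Hc _ _ (L2_conj_trunc mE Efin) hv.
  have fv0 x : (0 <= fine (v x))%R by exact: fine_ge0.
  have uE0 x : (0 <= cmod (u x) ^+ 2 * \1_(trunc_set B n) x)%R.
    by rewrite mulr_ge0 ?sqr_ge0.
  have mfv : measurable_fun [set: X] (fun x => fine (v x)).
    by apply: measurableT_comp => //; exact: (Ameasurable_measurable sAA).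
  move: vI.
  under eq_integral do rewrite cmod_real//.
  under [in leRHS]eq_integral do rewrite cmod_conj_trunc.
  rewrite integral_sqr_indic setTI.
  set I := \int[mu]_(x in trunc_set B n) _ => vI.
  have I0 : 0 <= I by apply: integral_ge0 => x _; rewrite lee_fin sqr_ge0.
  (* The truncation lies in [B], so testing on [B], which is in [AA], recovers all of [I]. *)
  have Iv : I = \int[mu]_(x in B) (fine (v x))%:E.
    have := hv; rewrite mul_conj_trunc => -[_ _ /(_ B AB)].
    under eq_integral do rewrite cmod_real//.
    rewrite /cRe/= !integral_sqr_indic.
    have -> : B `&` trunc_set B n = trunc_set B n.
      by rewrite /trunc_set setIA setIid.
    by move=> /(_ Efin)[].
  have {}vI : \int[mu]_(x in B) (fine (v x) ^+ 2)%:E <= c%:E * I.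
    apply: le_trans vI; apply: ge0_subset_integral => //.
      exact/measurable_EFinP/measurable_funX.
    by move=> x _; rewrite lee_fin sqr_ge0.
  have h2 : (2 * c)%:E * I <=
      \int[mu]_(x in B) (fine (v x) ^+ 2)%:E + (c ^+ 2)%:E * mu B.
    rewrite Iv -ge0_integralZl_EFin//; last 3 first.
    - by move=> x _; rewrite lee_fin.
    - exact/measurable_EFinP/measurable_funTS.
    - by rewrite mulr_ge0// ltW.
    rewrite -integral_cst// -ge0_integralD//; last 3 first.
    - by move=> x _; rewrite lee_fin sqr_ge0.
    - exact/measurable_EFinP/measurable_funX/measurable_funTS.
    - by move=> x _; rewrite lee_fin sqr_ge0.
    apply: ge0_le_integral => //.
    - by move=> x _; rewrite lee_fin !mulr_ge0// ltW.
    - by apply: measurable_funeM; exact/measurable_EFinP/measurable_funTS.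
    - apply: emeasurable_funD => //.
      exact/measurable_EFinP/measurable_funX/measurable_funTS.
    - move=> x _; rewrite -EFinM -EFinD lee_fin -subr_ge0.
      by rewrite (_ : _ - _ = (fine (v x) - c) ^+ 2)%R ?sqr_ge0//; ring.
  have Ifin : I \is a fin_num by rewrite ge0_fin_numE.
  have Bf : mu B \is a fin_num by rewrite ge0_fin_numE.
  (* This reads 2 c I <= c I + c^2 mu(B) with all terms finite; dividing by c finishes. *)
  move: (le_trans h2 (leeD2r _ vI)).
  rewrite -(fineK Ifin) -(fineK Bf) -!EFinM -EFinD !lee_fin => h3.
  by rewrite -(ler_pM2l c0); lra.
(* The bound is uniform in n, so monotone convergence along the truncations carries it to [B]. *)
rewrite -{1}(bigcup_trunc_set B).
have := @ge0_nondecreasing_set_cvg_integral _ _ _ (trunc_set B)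
  (fun x => (cmod (u x) ^+ 2)%:E) mu (@trunc_set_nd B).
move=> /(_ _ _ _)/cvg_lim <- //.
- apply: lime_le; last exact: nearW.
  apply: ereal_nondecreasing_is_cvgn.
  apply: ge0_nondecreasing_set_nondecreasing_integral => //.
  + exact: trunc_set_nd.
  + by move=> n; exact: measurable_trunc_set.
  + by move=> n; exact: measurable_funTS.
  + by move=> n x _; rewrite lee_fin sqr_ge0.
- by move=> n; exact: measurable_trunc_set.
- by move=> n; exact: measurable_funTS.
- by move=> n x _; rewrite lee_fin sqr_ge0.
Qed.

(** This is square integrability of T^* f. With k = E|f| one has |h|^2 <= 2 k^2, and pulling out k^2
    gives \int |u|^2 k^2 = \int w k^2 <= c \int k^2 <= c \int |f|^2. *)
Lemma integral_sqrM_lty (f h : X -> R[i]) :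
  L2 mu f -> condexp mu AA f h ->
  \int[mu]_x (cmod (u x) ^+ 2 * cmod (h x) ^+ 2)%:E < +oo.
Proof.
move=> [mf ffin] fh; have [c c0 Hc] := integral_sqr_le.
have mc := cmeasurable_cmod mf.
have mu2 := cmeasurable_sqr u_meas.
have [Ahr Ahi _] := fh.
have mh : cmeasurable h.
  by split; [exact: Ameasurable_measurable Ahr
            |exact: Ameasurable_measurable Ahi].
have mh2 := cmeasurable_sqr mh.
have [k fk] := condexp_nn_exists sAA sfAA mc (fun x => cmod_ge0 (f x)).
have [Ak k0 _] := fk.
have mk := Ameasurable_measurable sAA Ak.
have hk := condexp_le_condexp_nn sAA sfAA mf fh fk.
have [w uw] := condexp_nn_exists sAA sfAA
  ((measurable_EFinP _ _).1 mu2) (fun x => sqr_ge0 (cmod (u x))).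
have [Aw w0 uwB] := uw.
have mw := Ameasurable_measurable sAA Aw.
have wc : {ae mu, forall x, w x <= c%:E}.
  apply: (sub_ae_le sAA sfAA) => //.
  - by apply/(AmeasurableP sAA); exact: measurable_cst.
  - by move=> x; rewrite lee_fin ltW.
  - move=> B AB; rewrite integral_cst; last exact: (sub_measurable sAA).
    move=> cB; rewrite -uwB//; apply: Hc => //.
    (* Since c is positive, finiteness of c mu(B) forces that of mu(B). *)
    move: cB; rewrite !ltey; apply: contra => /eqP ->.
    by rewrite gt0_muley ?lte_fin.
have k20 x : 0 <= k x * k x by rewrite mule_ge0.
have mk2 : measurable_fun [set: X] (fun x => k x * k x).
  exact: emeasurable_funM.
(* The factor 2 collects the bounds for the squares of the real and imaginary parts. *)
apply: (@le_lt_trans _ _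
  (\int[mu]_x (2%:E * ((k x * k x) * (cmod (u x) ^+ 2)%:E)))).
  apply: ae_ge0_le_integral => //.
  - by move=> x _; rewrite lee_fin mulr_ge0 ?sqr_ge0.
  - under eq_fun do rewrite EFinM; exact: emeasurable_funM.
  - by move=> x _; rewrite !mule_ge0// lee_fin sqr_ge0.
  - by apply: measurable_funeM; exact: emeasurable_funM.
  - apply: filterS hk => x [hr hi] _.
    rewrite muleA mulrC EFinM; apply: lee_wpmul2r.
      by rewrite lee_fin sqr_ge0.
    rewrite cmod_sqr EFinD mule_natl mule2n.
    have sq r : `|r|%:E <= k x -> (r ^+ 2)%:E <= k x * k x.
      move=> rk; rewrite -real_normK ?num_real// expr2 EFinM.
      by rewrite lee_pmul ?lee_fin.
    by apply: leeD; exact: sq.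
rewrite ge0_integralZl_EFin//; last 2 first.
- by move=> x _; rewrite mule_ge0// lee_fin sqr_ge0.
- exact: emeasurable_funM.
rewrite (condexp_nn_pullout sAA mu2 _ uw)//; last 2 first.
- by move=> x; rewrite lee_fin sqr_ge0.
- by apply/(AmeasurableP sAA)/emeasurable_funM; exact/(AmeasurableP sAA).
apply: lte_mul_pinfty => //.
apply: (@le_lt_trans _ _ (\int[mu]_x (c%:E * (k x * k x)))).
  apply: ae_ge0_le_integral => //.
  - by move=> x _; rewrite mule_ge0.
  - exact: emeasurable_funM.
  - by move=> x _; rewrite mule_ge0// lee_fin ltW.
  - exact: measurable_funeM.
  - by apply: filterS wc => x wx _; rewrite muleC lee_wpmul2r.
rewrite ge0_integralZl_EFin//; last exact: ltW.
apply: lte_mul_pinfty => //; first by rewrite lee_fin ltW.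
apply: le_lt_trans ffin.
exact: condexp_nn_sqr_le (fun x => cmod_ge0 (f x)) fk.
Qed.

End bounded.

(** * Vanishing sets and the two implications *)

Section reducing.
Context (R : realType) (d : measure_display) (X : measurableType d).
Variables (mu : {measure set X -> \bar R}) (AA : set (set X)) (u : X -> R[i]).
Variable A : set X.
Hypothesis sAA : is_sub_sigma_algebra AA.
Hypothesis sfAA : sigma_finite_on AA mu.
Hypothesis u_meas : cmeasurable u.
Hypothesis mA : measurable A.
Local Open Scope ereal_scope.

(** Integrability of [f] makes [B] an admissible test set, on which the nonnegative [f] has the same
    integral as Re h, namely 0. *)
Lemma condexp_real_eq0 (f : X -> R) (h : X -> R[i]) (B : set X) :
  measurable_fun [set: X] f -> (forall x, (0 <= f x)%R) ->
  \int[mu]_x (f x)%:E < +oo ->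
  condexp mu AA (fun x => (f x)%:C%C) h -> AA B ->
  (forall x, B x -> h x = 0%R) -> {ae mu, forall x, B x -> f x = 0%R}.
Proof.
move=> mf f0 ffin [_ _ /(_ B)] + AB h0.
have mB := sub_measurable sAA AB.
have mEf : measurable_fun [set: X] (EFin \o f) by exact/measurable_EFinP.
move=> /(_ AB)[|_ fh _].
  under eq_integral do rewrite cmod_real//.
  apply: le_lt_trans ffin; apply: ge0_subset_integral => //.
  by move=> x _; rewrite lee_fin.
have : {ae mu, forall x, B x -> (f x)%:E = 0}.
  apply: ae_eq0_integral_le0 => //; first exact: measurable_funTS.
    by move=> x _; rewrite lee_fin.
  rewrite [leLHS]fh integral0_eq// => x Bx.
  by rewrite /cRe h0.
by apply: filterS => x /[apply] -[].
Qed.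

(** Both functions are nonnegative with equal integrals over [B], so vanishing passes from one to
    the other; [condexp_nn_eq0_on] is the reverse passage. *)
Lemma eq0_condexp_nn_eq0 (f k : X -> \bar R) (B : set X) :
  measurable_fun [set: X] f -> (forall x, 0 <= f x) ->
  condexp_nn mu AA f k -> AA B ->
  {ae mu, forall x, B x -> k x = 0} -> {ae mu, forall x, B x -> f x = 0}.
Proof.
move=> mf f0 [Ak k0 fk] AB kB; have mB := sub_measurable sAA AB.
apply: ae_eq0_integral_le0 => //; first exact: measurable_funTS.
rewrite fk// integral_eq0_ae//.
exact/measurable_funTS/(Ameasurable_measurable sAA).
Qed.

Lemma condexp_nn_eq0_on (f k : X -> \bar R) (B : set X) :
  measurable_fun [set: X] f -> (forall x, 0 <= f x) ->
  condexp_nn mu AA f k -> AA B ->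
  {ae mu, forall x, B x -> f x = 0} -> {ae mu, forall x, B x -> k x = 0}.
Proof.
move=> mf f0 [Ak k0 fk] AB fB; have mB := sub_measurable sAA AB.
apply: ae_eq0_integral_le0 => //.
  exact/measurable_funTS/(Ameasurable_measurable sAA).
by rewrite -fk// integral_eq0_ae//; exact: measurable_funTS.
Qed.

Lemma sub_preimage_set1 (g : X -> \bar R) y :
  Ameasurable AA g -> AA [set x | g x = y].
Proof. by move=> Ag; exact: (Ag [set y]). Qed.

Let mindicA : measurable_fun [set: X] (fun x => (\1_A x : R)%:E).
Proof. exact/measurable_EFinP/measurable_indic. Qed.

Let indicA_ge0 x : 0 <= (\1_A x : R)%:E.
Proof. by rewrite lee_fin. Qed.

Let mu2 : measurable_fun [set: X] (fun x => (cmod (u x) ^+ 2)%:E).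
Proof. exact: cmeasurable_sqr. Qed.

Let u2_ge0 x : 0 <= (cmod (u x) ^+ 2)%:E.
Proof. by rewrite lee_fin sqr_ge0. Qed.

Let sqr_cmod_eq0 (z : R[i]) : (cmod z ^+ 2)%:E = 0 -> z = 0%R.
Proof. by move=> [] /eqP; rewrite sqrf_eq0 cmod_eq0 => /eqP. Qed.

Lemma condexp_indic_reduces (gA w : X -> \bar R) :
  EMu_bounded mu AA u ->
  condexp_nn mu AA (fun x => (\1_A x : R)%:E) gA ->
  condexp_nn mu AA (fun x => ((cmod (u x)) ^+ 2)%:E) w ->
  {ae mu, forall x, w x != 0 -> gA x = (\1_A x : R)%:E} ->
  reduces_EMu mu AA u A.
Proof.
move=> u_bounded hgA hw gAE.
have [AgA gA0 _] := hgA; have [Aw w0 _] := hw.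
have AW := sub_preimage_set1 0 Aw.
have AP := sub_preimage_set1 0 AgA.
have uW : {ae mu, forall x, w x = 0 -> u x = 0%R}.
  have := eq0_condexp_nn_eq0 mu2 u2_ge0 hw AW
    (aeW mu (fun x (h : w x = 0) => h)).
  by apply: filterS => x h wx; exact: sqr_cmod_eq0 (h wx).
have AgA0 : {ae mu, forall x, gA x = 0 -> ~ A x}.
  have := eq0_condexp_nn_eq0 mindicA indicA_ge0 hgA AP
    (aeW mu (fun x (h : gA x = 0) => h)).
  apply: filterS => x h /h + Ax; rewrite indicE mem_set// => -[] /eqP.
  by rewrite oner_eq0.
have fP f : L2_on mu A f -> {ae mu, forall x, gA x = 0 -> f x = 0%R}.
  by move=> [_ f0]; apply: filterS2 f0 AgA0 => x fA gAA /gAA; exact: fA.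
(* Where [w] is nonzero, [gA] agrees with the indicator of [A], which is 0 off [A]. *)
have notA : {ae mu, forall x, ~ A x -> w x = 0 \/ gA x = 0}.
  apply: filterS gAE => x + nAx; have [->|wx] := eqVneq (w x) 0; first by left.
  by move=> /(_ isT) ->; right; rewrite indicE memNset.
split => [f fA g fg|f fA h fh]; have [[mf ffin] f0] := fA; have f0P := fP _ fA.
- have [c _ Hc] := EMu_bounded_sqr u_bounded.
  have [Lg _] := Hc _ _ (conj mf ffin) fg; split => //.
  have muf := cmeasurableM u_meas mf.
  (* On {w = 0} the factor [u] kills u f, and on {gA = 0} the factor [f] does; both sets are in
     [AA], so E(u f) vanishes there too. *)
  have gW : {ae mu, forall x, w x = 0 -> g x = 0%R}.
    apply: condexp_eq0 muf fg AW _ => //.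
    by apply: filterS uW => x h /h ->; rewrite mul0r.
  have gP : {ae mu, forall x, gA x = 0 -> g x = 0%R}.
    apply: condexp_eq0 muf fg AP _ => //.
    by apply: filterS f0P => x h /h ->; rewrite mulr0.
  apply: filterS3 notA gW gP => x nA gw gp /= /nA[]; [exact: gw|exact: gp].
- have hP : {ae mu, forall x, gA x = 0 -> h x = 0%R}.
    exact: condexp_eq0 mf fh AP f0P.
  split; last first.
    (* On {w = 0} it is conj(u) that vanishes, on {gA = 0} it is [h]. *)
    apply: filterS3 notA uW hP => x nA uw hp /= /nA[/uw ->|/hp ->].
      by rewrite rmorph0 mul0r.
    by rewrite mulr0.
  have [Ahr Ahi _] := fh; split.
    apply: cmeasurableM; first exact: cmeasurable_conj.
    by split; [exact: Ameasurable_measurable Ahr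
              |exact: Ameasurable_measurable Ahi].
  under eq_integral do rewrite cmodM cmod_conj exprMn.
  exact: integral_sqrM_lty (conj mf ffin) fh.
Qed.

Lemma reduces_condexp_indic (gA w : X -> \bar R) :
  reduces_EMu mu AA u A ->
  condexp_nn mu AA (fun x => (\1_A x : R)%:E) gA ->
  condexp_nn mu AA (fun x => ((cmod (u x)) ^+ 2)%:E) w ->
  {ae mu, forall x, w x != 0 -> gA x = (\1_A x : R)%:E}.
Proof.
move=> [redT redT'] hgA hw.
have [AgA gA0 gAB] := hgA; have [Aw w0 wB] := hw.
have [F FT FA] := sfAA.
have mAF i : measurable (A `&` F i).
  by apply: measurableI => //; exact: (sub_measurable sAA (FA i).1).
have AFfin i : mu (A `&` F i) < +oo.
  apply: le_lt_trans (FA i).2; apply: le_measure; rewrite ?inE//.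
  exact: (sub_measurable sAA (FA i).1).
have mind i : measurable_fun [set: X] (\1_(A `&` F i) : X -> R).
  exact: measurable_indic.
have ind0 i x : (0 <= \1_(A `&` F i) x :> R)%R by [].
have indfin i : \int[mu]_x (\1_(A `&` F i) x : R)%:E < +oo.
  by rewrite integral_indic// setIT.
have : forall i, exists h,
    condexp mu AA (fun x => (\1_(A `&` F i) x : R)%:C%C) h.
  move=> i; have [k hk] := condexp_nn_exists sAA sfAA (mind i) (ind0 i).
  by eexists; apply: condexp_nn_condexp hk.
move=> /choice[h hh].
(* [P] is the complement of N, computed with the chosen versions [h i]. *)
pose P := \bigcap_i [set x | h i x = 0%R].
have AP : AA P.
  apply: (sub_sigma_bigcap sAA) => i; have [Ahr Ahi _] := hh i.
  rewrite (_ : [set _ | _] =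
      cRe (h i) @^-1` [set 0%R] `&` cIm (h i) @^-1` [set 0%R]).
    by apply: (sub_sigma_setI sAA); [exact: Ahr|exact: Ahi].
  apply/seteqP; split => x /=; rewrite /cRe/= /cIm/=; first by move=> ->.
  by case: (h i x) => a b /= [-> ->].
have AP0 : {ae mu, forall x, P x -> ~ A x}.
  have : {ae mu, forall x i, P x -> \1_(A `&` F i) x = 0%R :> R}.
    apply: ae_foralln => i; apply: (condexp_real_eq0 _ _ _ (hh i)) => //.
    by move=> x /(_ i I).
  apply: filterS => x hx Px Ax.
  have [i _ Fix] : (\bigcup_i F i) x by rewrite -FT.
  have /eqP := hx i Px; rewrite indicE mem_set ?oner_eq0//.
(* The indicator of A n F_i is in L^2(A), so conj(u) h_i is 0 off [A]; outside [P] some h_i is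
   nonzero, which leaves u = 0. *)
have uN : {ae mu, forall x, ~ P x -> ~ A x -> u x = 0%R}.
  have : {ae mu, forall x i, ~ A x -> (u x)^* * h i x = 0%R}%R.
    apply: ae_foralln => i; apply: (redT' _ _ _ (hh i)).2; split.
      split; first exact: cmeasurable_real.
      under eq_integral do rewrite cmod_real//.
      rewrite (eq_integral (fun x => (\1_(A `&` F i) x)%:E))// => x _.
      by rewrite indicE; case: (_ \in _); rewrite ?expr1n ?expr0n.
    by apply: aeW => x nAx; rewrite indicE memNset// => -[].
  apply: filterS => x ux nPx nAx.
  have /existsNP[i hi] : ~ forall i, h i x = 0%R.
    by move=> hx; apply: nPx => i _.
  have /eqP := ux i nAx; rewrite mulf_eq0 conjC_eq0 => /orP[/eqP//|/eqP hi0].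
  by exfalso; apply: hi.
(* Finite measure and bounded |u| put conj(u) 1_E in L^2(A). *)
pose E i n := trunc_set u (A `&` F i) n.
have mE i n : measurable (E i n) by exact: measurable_trunc_set.
have Efin i n := trunc_set_fin u_meas n (mAF i) (AFfin i).
have : forall p : nat * nat, exists v : X -> \bar R,
    condexp mu AA (fun x => u x * conj_trunc u (E p.1 p.2) x)%R
      (fun x => (fine (v x))%:C%C) /\ Ameasurable AA v.
  move=> [i n]; have [v [Av _ _] hv] :=
    condexp_conj_trunc sAA sfAA u_meas (mE i n) (Efin i n).
  by exists v.
move=> /choice[v' hv']; pose v i n := v' (i, n).
have hv i n : condexp mu AA (fun x => u x * conj_trunc u (E i n) x)%R
    (fun x => (fine (v i n x))%:C%C) /\ Ameasurable AA (v i n) := hv' (i, n).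
have vA : {ae mu, forall x i n, ~ A x -> fine (v i n x) = 0%R}.
  apply: ae_foralln => i; apply: ae_foralln => n.
  have : L2_on mu A (fun x => (fine (v i n x))%:C%C).
    apply: redT (hv i n).1; split.
      exact: (L2_conj_trunc u_meas (mE i n) (Efin i n)).
    apply: aeW => x nAx; rewrite /conj_trunc indicE memNset ?mulr0//.
    by move=> [[]].
  by move=> [_]; apply: filterS => x /[apply] -[].
(* [Z] is the part of N where all images of the test functions vanish. There |u|^2 1_E = 0 for every
   E, so u = 0 on [A], and also off [A] by [uN]; hence w = 0 almost everywhere on [Z]. *)
pose Z := ~` P `&` \bigcap_i \bigcap_n [set x | fine (v i n x) = 0%R].
have AZ : AA Z.
  apply: (sub_sigma_setI sAA); first exact: (sub_sigma_setC sAA).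
  apply: (sub_sigma_bigcap sAA) => i; apply: (sub_sigma_bigcap sAA) => n.
  have Afv : Ameasurable AA (fun x => fine (v i n x)).
    apply/(AmeasurableP sAA); apply: measurableT_comp => //.
    exact/(AmeasurableP sAA)/(hv i n).2.
  exact: (Afv [set 0%R]).
have uZA : {ae mu, forall x i n, Z x -> (cmod (u x) ^+ 2 * \1_(E i n) x = 0)%R}.
  apply: ae_foralln => i; apply: ae_foralln => n.
  have := (hv i n).1; rewrite mul_conj_trunc => hvin.
  apply: condexp_real_eq0 hvin AZ _.
  - apply: measurable_funM; last exact: measurable_indic.
    exact/measurable_funX/cmeasurable_cmod.
  - by move=> x; rewrite mulr_ge0 ?sqr_ge0.
  - by rewrite integral_sqr_indic setTI; exact: Efin.
  - by move=> x [_ /(_ i I n I)/= ->].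
have wZ : {ae mu, forall x, Z x -> w x = 0}.
  apply: (condexp_nn_eq0_on mu2 u2_ge0 hw AZ).
  apply: filterS2 uN uZA => x un uz Zx.
  have [Ax|nAx] := pselect (A x); last first.
    by rewrite un// ?cmod0 ?expr0n//; case: Zx.
  have [i _ Fix] : (\bigcup_i F i) x by rewrite -FT.
  have [n _ Ex] : (\bigcup_n E i n) x by rewrite bigcup_trunc_set.
  by have := uz i n Zx; rewrite indicE mem_set// mulr1 => ->.
pose M := ~` P `&` [set x | w x <> 0].
have AM : AA M.
  apply: (sub_sigma_setI sAA); first exact: (sub_sigma_setC sAA).
  apply: (@sub_sigma_setC _ _ _ sAA [set x | w x = 0]).
  exact: sub_preimage_set1.
(* Almost every point of [M] off [A] would lie in [Z] by [vA], contradicting that [w] is nonzero on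
   [M]. *)
have MA : {ae mu, forall x, M x -> A x}.
  apply: filterS2 vA wZ => x va wz [nPx wx]; apply: contrapT => nAx.
  by apply/wx/wz; split => // i _ n _; exact: va.
have mM := sub_measurable sAA AM.
have gA_le1 : {ae mu, forall x, gA x <= 1}.
  apply: (sub_ae_le sAA sfAA) => //.
    by apply/(AmeasurableP sAA); exact: measurable_cst.
  move=> B AB _; have mB := sub_measurable sAA AB; rewrite -gAB//.
  apply: ge0_le_integral => //; first exact: measurable_funTS.
  by move=> x _; rewrite lee_fin indicE; case: (_ \in _).
(* [M] is in [AA] and almost contained in [A], so 1_M = E(1_M) <= E(1_A). *)
have gA_ge1 : {ae mu, forall x, (\1_M x : R)%:E <= gA x}.
  apply: (sub_ae_le sAA sfAA) => //.
    apply/(AmeasurableP sAA)/measurable_EFinP/measurable_indic.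
    by rewrite measurable_subE.
  move=> B AB _; have mB := sub_measurable sAA AB; rewrite -gAB//.
  apply: ae_ge0_le_integral => //.
  - by apply/measurable_EFinP; exact: measurable_indic.
  - exact: measurable_funTS.
  - apply: filterS MA => x MAx _; rewrite lee_fin !indicE ler_nat.
    have [|] := boolP (x \in M) => //.
    by rewrite inE => /MAx Ax; rewrite mem_set.
have gAP : {ae mu, forall x, P x -> gA x = 0}.
  apply: (condexp_nn_eq0_on mindicA indicA_ge0 hgA AP).
  by apply: filterS AP0 => x /[apply] nAx; rewrite indicE memNset.
have all : {ae mu, forall x, (P x -> ~ A x) /\ (P x -> gA x = 0)}.
  exact: filterS2 AP0 gAP.
have all2 : {ae mu, forall x, gA x <= 1 /\ (\1_M x : R)%:E <= gA x}.
  exact: filterS2 gA_le1 gA_ge1.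
apply: filterS3 all all2 MA => x [pA pg] [g1 gM] ma wx.
(* On [P] both sides are 0; off [P] the point lies in [M], where both are 1. *)
have [Px|nPx] := pselect (P x).
  by rewrite pg// indicE memNset//; exact: pA.
have Mx : M x by split => //; exact/eqP.
rewrite indicE mem_set; last exact: ma.
by apply/eqP; rewrite eq_le g1/=; move: gM; rewrite indicE mem_set.
Qed.

End reducing.

Theorem theorem2p3 (R : realType) (d : measure_display) (X : measurableType d)
  (mu : {measure set X -> \bar R}) (AA : set (set X)) (u : X -> R[i])
  (A : set X)
  (mu_complete : measure_is_complete mu)
  (mu_sfinite : sigma_finite setT mu)
  (AA_sub : is_sub_sigma_algebra AA)
  (AA_sfinite : sigma_finite_on AA mu)
  (u_meas : cmeasurable u)
  (Eu_finite : forall g, condexp_nn mu AA (fun x => (cmod (u x))%:E) g ->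
                 {ae mu, forall x, (g x < +oo)%E})
  (bounded : EMu_bounded mu AA u)
  (A_meas : measurable A) :
  reduces_EMu mu AA u A <->
  (forall gA w,
     condexp_nn mu AA (fun x => (\1_A x : R)%:E) gA ->
     condexp_nn mu AA (fun x => ((cmod (u x)) ^+ 2)%:E) w ->
     {ae mu, forall x, w x != 0%E -> gA x = (\1_A x : R)%:E}).
Proof.
split=> [red gA w hgA hw|H].
  exact: (reduces_condexp_indic AA_sub AA_sfinite u_meas A_meas red hgA hw).
(* The condition quantifies over all versions of the two conditional expectations, so one of each
   must be produced before it can be used. *)
have mA : measurable_fun [set: X] (\1_A : X -> R) by exact: measurable_indic.
have A0 x : 0 <= \1_A x :> R by [].
have [gA hgA] := condexp_nn_exists AA_sub AA_sfinite mA A0.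
have mu2 : measurable_fun [set: X] (fun x => cmod (u x) ^+ 2).
  exact/measurable_funX/cmeasurable_cmod.
have [w hw] := condexp_nn_exists AA_sub AA_sfinite mu2
  (fun x => sqr_ge0 (cmod (u x))).
exact: (condexp_indic_reduces AA_sub AA_sfinite u_meas A_meas bounded hgA hw
  (H _ _ hgA hw)).
Qed.
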